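(* Let $M$ be a sparse paving matroid with ground set $E$, let $\psi\colon E\to\Gamma$ be a map to an abelian group $\Gamma$, and let $F\subseteq\Gamma$ be a finite set. Suppose $M$ has at least one $F$-avoiding basis. Then for every basis $A$ of $M$ there exists an $F$-avoiding basis $B$ of $M$ with $|A\setminus B|\le |F|$.
   Context: For $X\subseteq E$, write $\psi(X)\coloneqq\sum_{e\in X}\psi(e)$; $X$ is called $F$-avoiding if $\psi(X)\notin F$. A matroid of rank $r$ is paving if every circuit has size $r$ or $r+1$; it is sparse paving if both it and its dual are paving. Equivalently, a rank-$r$ matroid $M$ on $E$ is sparse paving iff there is a family $\mathcal H$ of $r$-subsets of $E$ with $|H_1\cap H_2|\le r-2$ for distinct $H_1,H_2\in\mathcal H$ such that the bases are exactly the $r$-subsets of $E$ not in $\mathcal H$. *)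

(* Defs.v *)
From HB Require Import structures.
From mathcomp Require Import all_boot all_order all_algebra finmap.
Set Implicit Arguments.
Unset Strict Implicit.
Unset Printing Implicit Defensive.

Import GRing.Theory.

Definition basis_exchange (E : finType) (BB : {set {set E}}) : Prop :=
  forall B1 B2 : {set E}, B1 \in BB -> B2 \in BB ->
  forall x, x \in B1 :\: B2 ->
  exists2 y, y \in B2 :\: B1 & y |: (B1 :\ x) \in BB.

(* The ground set is the whole finite type E. *)
Record matroid (E : finType) := Matroid {
  bases : {set {set E}};
  bases_neq0 : bases != set0;
  basesX : basis_exchange bases
}.

Section Dual.
Variables (E : finType) (M : matroid E).

Lemma bases_sub_eq (B1 B2 : {set E}) :
  B1 \in bases M -> B2 \in bases M -> B1 \subset B2 -> B1 = B2.
Proof.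
move=> h1 h2 s12; apply/eqP; rewrite eqEsubset s12 /=.
apply/subsetP => x x2; apply/negPn/negP => x1.
have [|y] := basesX h2 h1 (x := x); first by rewrite inE x1.
by rewrite inE => /andP[y2 /(subsetP s12)]; rewrite (negPf y2).
Qed.

(* Adding x \in B2 :\: B1 to the basis B1 can be compensated by removing an
   element of B1 :\: B2: among the bases containing x |: (B1 :&: B2), take
   one that minimizes #|B :\: B1|. *)
Lemma basis_coexchange (B1 B2 : {set E}) x :
  B1 \in bases M -> B2 \in bases M -> x \in B2 :\: B1 ->
  exists2 y, y \in B1 :\: B2 & x |: (B1 :\ y) \in bases M.
Proof.
move=> h1 h2; rewrite inE => /andP[xN1 x2].
pose P := [pred B | (B \in bases M) && (x |: (B1 :&: B2) \subset B)].
have P2 : P B2 by rewrite /= h2 subUset sub1set x2 subsetIr.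
case: (arg_minnP (fun B : {set E} => #|B :\: B1|) P2) => B /andP[hB sB] minB.
have xB : x \in B by apply: (subsetP sB); rewrite !inE eqxx.
have sBx z : z \in B -> z \notin B1 -> z = x.
  move=> zB zN1; apply/eqP/negPn/negP => zx.
  have [|y] := basesX hB h1 (x := z); first by rewrite inE zN1.
  rewrite inE => /andP[yNB y1] hB'.
  have /minB : P (y |: (B :\ z)).
    rewrite /= hB' /=; apply/subsetP => t tI.
    rewrite !inE (subsetP sB _ tI) andbT orbC.
    case: eqP => //= tz; move: tI.
    by rewrite tz !inE (negPf zx) (negPf zN1).
  rewrite leqNgt => /negP[]; apply: proper_card; apply/properP; split.
    apply/subsetP => t; rewrite !inE => /andP[tN1 /orP[/eqP ty|/andP[_ ->]]].
      by rewrite ty y1 in tN1.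
    by rewrite tN1.
  exists z; rewrite !inE ?zN1 // eqxx orbF /=.
  by apply: contraNN zN1 => /eqP ->.
have [|y] := basesX hB h1 (x := x); first by rewrite inE xN1.
rewrite inE => /andP[yNB y1] hB'.
have yB1 : y |: (B :\ x) = B1.
  apply: bases_sub_eq => //; apply/subsetP => t.
  rewrite !inE => /orP[/eqP ->//|/andP[tx tB]].
  by apply/negPn/negP => /(sBx _ tB) /eqP; rewrite (negPf tx).
exists y.
  rewrite inE y1 andbT; apply: contraNN yNB => y2.
  by apply: (subsetP sB); rewrite !inE y1 y2 orbT.
suff -> : x |: (B1 :\ y) = B by [].
rewrite -yB1; apply/setP => t; rewrite !inE.
have [->|tx] //= := eqVneq t x.
by have [->|] //= := eqVneq t y; rewrite (negPf yNB).
Qed.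

Definition dual_bases : {set {set E}} := [set ~: B | B in bases M].

Lemma in_dual_bases (B : {set E}) : (B \in dual_bases) = (~: B \in bases M).
Proof. by rewrite -{1}(setCK B) mem_imset //; apply: can_inj (@setCK _). Qed.

Lemma dual_bases_neq0 : dual_bases != set0.
Proof.
have /set0Pn[B hB] := bases_neq0 M.
by apply/set0Pn; exists (~: B); rewrite in_dual_bases setCK.
Qed.

Lemma dual_basesX : basis_exchange dual_bases.
Proof.
move=> B1 B2; rewrite !in_dual_bases => h1 h2 x xD.
have [|y yD hB] := basis_coexchange (x := x) h1 h2.
  by move: xD; rewrite !inE negbK andbC.
exists y; first by move: yD; rewrite !inE negbK andbC.
rewrite in_dual_bases.
suff -> : ~: (y |: (B1 :\ x)) = x |: (~: B1 :\ y) by [].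
have xy : x != y.
  by apply: contraTneq yD => <-; move: xD; rewrite !inE negbK => /andP[/negPf->].
apply/setP => t; rewrite !inE negb_or negb_and negbK.
by have [->|_] //= := eqVneq t x; rewrite ?xy.
Qed.

Definition dual : matroid E := Matroid dual_bases_neq0 dual_basesX.

End Dual.

Section Paving.
Variables (E : finType) (M : matroid E).

Definition rank : nat := \max_(B in bases M) #|B|.

Definition indep (X : {set E}) : bool :=
  [exists B in bases M, X \subset B].

Definition circuit (C : {set E}) : bool :=
  minset (fun X : {set E} => ~~ indep X) C.

Definition paving : Prop :=
  forall C : {set E}, circuit C -> #|C| = rank \/ #|C| = rank.+1.

End Paving.

Definition sparse_paving (E : finType) (M : matroid E) : Prop :=
  paving M /\ paving (dual M).

Definition avoiding (E : finType) (Gamma : zmodType) (psi : E -> Gamma)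
    (F : {fset Gamma}) (X : {set E}) : bool :=
  (\sum_(e in X) psi e)%R \notin F.

(* Main.v *)
(* In a sparse paving matroid two r-sets differing by one exchange are never
   both non-bases. Let B be an F-avoiding basis closest to A, and suppose that
   k = |A \ B| > |F|. Among the r-sets between A :&: B and A :|: B, every one
   other than B whose weight avoids F is a non-basis, so no two of these are
   adjacent. By pigeonhole along a path from A to B, some r-set T <> B has the
   weight of B. A set separating two elements of equal weight lying on the same
   side of T has its weight in F, since exchanging these two elements gives an
   adjacent set of the same weight. If the weights on T are distinct, exchanging
   each element of T with one fixed outside element gives k values in F.
   Otherwise take u1, u2 in T of equal weight and a transversal R of the weight
   classes outside T: the exchanges of u1 with R give |R| values in F, and each
   of the k - |R| further exchanges, with outside elements not in R, contributes
   a new value. In both cases |F| >= k. *)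
Require Import Defs.
From HB Require Import structures.
From mathcomp Require Import all_boot all_order all_algebra finmap zify.

Set Implicit Arguments.
Unset Strict Implicit.
Unset Printing Implicit Defensive.

Import GRing.Theory.

(** * Exchanges and bases of sparse paving matroids *)

Definition swap (E : finType) (I : {set E}) (s t : E) : {set E} := t |: (I :\ s).

Lemma in_swap (E : finType) (I : {set E}) s t x :
  (x \in swap I s t) = (x == t) || (x != s) && (x \in I).
Proof. by rewrite !inE. Qed.

Section SparsePaving.
Variables (E : finType) (M : matroid E).

Lemma card_swap (I : {set E}) s t :
  s \in I -> t \notin I -> #|swap I s t| = #|I|.
Proof.
move=> sI tI; rewrite cardsU1 !inE (negPf tI) andbF /=.
by rewrite (cardsD1 s I) sI.
Qed.

(** An exchange towards [B2] preserves the size of [B1] and shrinks [B1 :\: B2], on which the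
    induction runs. *)
Lemma bases_card (B1 B2 : {set E}) :
  B1 \in bases M -> B2 \in bases M -> #|B1| = #|B2|.
Proof.
move: {2}_.+1 (ltnSn #|B1 :\: B2|) => n.
elim: n B1 => // n IHn B1 ltn h1 h2.
have [|/set0Pn[x xD]] := boolP (B1 :\: B2 == set0).
  by rewrite setD_eq0 => s12; rewrite (bases_sub_eq h1 h2 s12).
have [y yD hB] := basesX h1 h2 xD.
move: (xD) (yD); rewrite !inE => /andP[xN2 x1] /andP[yN1 y2].
rewrite -(card_swap x1 yN1); apply: IHn => //.
rewrite -ltnS; apply: leq_trans ltn; rewrite ltnS; apply: proper_card.
apply/properP; split.
  apply/subsetP => z; rewrite !inE => /andP[zN2 /orP[/eqP zy|/andP[_ ->]]].
    by rewrite zy y2 in zN2.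
  by rewrite zN2.
exists x; rewrite ?xD // !inE eqxx orbF (negPf xN2) /=.
by apply: contraNN yN1 => /eqP <-.
Qed.

Lemma rank_card (B : {set E}) : B \in bases M -> rank M = #|B|.
Proof.
move=> hB; apply/eqP; rewrite eqn_leq /rank (leq_bigmax_cond _ hB) andbT.
by apply/bigmax_leqP => B' hB'; rewrite (bases_card hB' hB).
Qed.

Lemma paving_indep (X : {set E}) : paving M -> #|X| < rank M -> indep M X.
Proof.
move=> pM ltX; case: (boolP (indep M X)) => // nX.
have [C cC sCX] := minset_exists (P := fun Y => ~~ indep M Y) nX.
have := subset_leq_card sCX.
by case: (pM C cC) => ->; lia.
Qed.

End SparsePaving.

(** Paving of [M] extends [I :\ s] to a basis [B1] by one element [z]; paving of the dual yields a
    basis [B0] inside [t |: I]. If [z] is neither [s] nor [t], exchanging it towards [B0] replaces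
    it by [s] or [t], and [s] would make [I] a basis. *)
Lemma nonbasis_swap (E : finType) (M : matroid E) (I : {set E}) s t :
  sparse_paving M -> #|I| = rank M -> s \in I -> t \notin I ->
  I \notin bases M -> swap I s t \in bases M.
Proof.
move=> [pM pD] cI sI tI nI.
have /existsP[B1 /andP[h1 sub1]] : indep M (I :\ s).
  by apply: paving_indep => //; rewrite -cI (cardsD1 s I) sI.
have /existsP[B0' /andP[h0 sub0]] : indep (dual M) (~: (t |: I)).
  apply: paving_indep => //; have /set0Pn[B hB] := bases_neq0 M.
  have hB' : ~: B \in bases (dual M) by rewrite /= in_dual_bases setCK.
  rewrite (rank_card hB'); have := cardsC B; have := cardsC (t |: I).
  rewrite -(rank_card hB) -cI cardsU1 tI => /=; lia.
move: h0; rewrite /= in_dual_bases; set B0 := ~: B0' => h0.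
have {}sub0 : B0 \subset t |: I by rewrite -setCS setCK.
clearbody B0.
have [z zN eB1] : exists2 z, z \notin I :\ s & B1 = z |: (I :\ s).
  have : #|B1 :\: (I :\ s)| == 1.
    by rewrite cardsDS // -(rank_card h1) -cI (cardsD1 s I) sI addnK.
  case/cards1P => z ez; exists z.
    by have := set11 z; rewrite -ez inE => /andP[].
  by rewrite -ez setUC -{1}(setIidPr sub1) setID.
have [zs|zs] := eqVneq z s.
  by move: nI; rewrite -(setD1K sI) -{1}zs -eB1 h1.
have [zt|zt] := eqVneq z t; first by rewrite /swap -zt -eB1.
have zNI : z \notin I by move: zN; rewrite !inE zs.
have zD : z \in B1 :\: B0.
  rewrite inE eB1 !inE eqxx andbT; apply: contraNN zNI => zB0.
  by have := subsetP sub0 _ zB0; rewrite !inE (negPf zt).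
have [y yD] := basesX h1 h0 zD.
have -> : B1 :\ z = I :\ s by rewrite eB1 setU1K.
move: yD; rewrite inE eB1 !inE negb_or negb_and negbK.
case/andP=> /andP[yz yN] yB0.
have := subsetP sub0 _ yB0; rewrite !inE => /orP[/eqP->//|yI].
by move: yN; rewrite yI orbF => /eqP->; rewrite setD1K // (negPf nI).
Qed.

(** * Weights of sets and transversals of weight classes *)

Section Weights.
Variables (E : finType) (Gamma : zmodType) (psi : E -> Gamma).

Definition weight (X : {set E}) : Gamma := (\sum_(e in X) psi e)%R.

Lemma weight_swap (I : {set E}) s t : s \in I -> t \notin I ->
  weight (swap I s t) = (weight I + (psi t - psi s))%R.
Proof.
move=> sI tI; rewrite /weight big_setU1 ?inE ?(negPf tI) ?andbF //=.
by rewrite (big_setD1 s sI) /= [RHS]addrC addrA subrK.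
Qed.

Lemma weightID (X Y : {set E}) :
  weight X = (weight (X :&: Y) + weight (X :\: Y))%R.
Proof. exact: big_setID. Qed.

Lemma weightU (X Y : {set E}) : [disjoint X & Y] ->
  weight (X :|: Y) = (weight X + weight Y)%R.
Proof. by move=> dXY; rewrite /weight -bigU //; apply: eq_bigl => x; rewrite !inE. Qed.

Lemma psi_transversal (X : {set E}) : exists R : {set E},
  [/\ R \subset X, {in R &, injective psi} &
      forall x, x \in X -> exists2 y, y \in R & psi y = psi x].
Proof.
(* For [x] in [X] the choice depends only on [psi x], so [psi] is injective on the image; the
   default [x] is then never reached. *)
pose r x := odflt x [pick y in X | psi y == psi x].
have rP x : x \in X -> r x \in X /\ psi (r x) = psi x.
  move=> xX; rewrite /r; case: pickP => [y /andP[yX /eqP->]//|/(_ x)].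
  by rewrite /= xX eqxx.
exists (r @: X); split.
- by apply/subsetP => _ /imsetP[x xX ->]; case: (rP x xX).
- move=> _ _ /imsetP[x xX ->] /imsetP[y yX ->].
  have [_ ->] := rP x xX; have [_ ->] := rP y yX => exy.
  by rewrite /r exy; case: pickP => // /(_ y); rewrite /= yX eqxx.
- by move=> x xX; exists (r x); [exact: imset_f | case: (rP x xX)].
Qed.

End Weights.

(** * Sets between [A :&: B] and [A :|: B] *)

Section Interval.
Variables (E : finType) (Gamma : zmodType) (psi : E -> Gamma).
Variables (F : {fset Gamma}) (A B : {set E}).

Local Notation wt := (weight psi).

Definition between (I : {set E}) : bool :=
  [&& A :&: B \subset I, I \subset A :|: B & #|I| == #|A|].

Local Notation movable x := ((x \in A) != (x \in B)).

Hypothesis cAB : #|A| = #|B|.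
Hypothesis wtA : wt A \in F.
Hypothesis wtB : wt B \notin F.
(** This is all that the matroid has to supply: of two adjacent sets one is a basis, and minimality
    of [B] puts the weight of a basis in between, other than [B], in [F]. *)
Hypothesis isolated : forall I s t,
  between I -> s \in I -> t \notin I -> movable s -> movable t ->
  I != B -> swap I s t != B -> (wt I \in F) || (wt (swap I s t) \in F).

Lemma between_swap I s t : between I -> s \in I -> t \notin I ->
  movable s -> movable t -> between (swap I s t).
Proof.
case/and3P=> /subsetP s1 /subsetP s2 cI sI tI ms mt.
apply/and3P; split; last by rewrite card_swap.
- apply/subsetP => x xAB; rewrite !inE (s1 _ xAB) andbT.
  apply/orP; right; apply: contraNneq ms => <-.
  by move: xAB; rewrite inE => /andP[-> ->].
- apply/subsetP => x; rewrite inE in_setD1 in_set1.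
  case/orP=> [/eqP->|/andP[_ /s2//]].
  by move: mt; rewrite inE; do 2 case: (_ \in _).
Qed.

Lemma betweenA : between A.
Proof. by rewrite /between subsetIl subsetUl eqxx. Qed.

Lemma betweenB : between B.
Proof. by rewrite /between subsetIr subsetUr cAB eqxx. Qed.

Lemma between_memI I x : between I -> x \in A -> x \in B -> x \in I.
Proof. by case/and3P=> /subsetP sI _ _ xA xB; apply: sI; rewrite inE xA. Qed.

Lemma between_memU I x : between I -> x \in I -> (x \in A) || (x \in B).
Proof. by case/and3P=> _ /subsetP sI _ /sI; rewrite inE. Qed.

Lemma card_between I : between I -> #|I| = #|A|.
Proof. by case/and3P=> _ _ /eqP. Qed.

Lemma card_movable_in T : between T ->
  #|[set x in T | movable x]| = #|A :\: B|.
Proof.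
move=> bT; have -> : [set x in T | movable x] = T :\: (A :&: B).
  apply/setP => x; rewrite !inE andbC.
  have [xT|] := boolP (x \in T); rewrite ?andbF // !andbT.
  by have := between_memU bT xT; do 2 case: (_ \in _).
case/and3P: bT => sT _ /eqP cT.
by rewrite cardsDS // cT cardsD.
Qed.

Lemma card_movable_out T : between T ->
  #|[set x in ~: T | movable x]| = #|A :\: B|.
Proof.
move=> bT; have -> : [set x in ~: T | movable x] = (A :|: B) :\: T.
  apply/setP => x; rewrite !inE.
  have [//|xT] := boolP (x \in T); rewrite /=.
  have := between_memI bT (x := x); rewrite (negPf xT).
  by case: (x \in A) (x \in B) => [] [] // /(_ isT isT).
case/and3P: bT => _ sT /eqP cT.
rewrite cardsDS // cT cardsU cardsD -cAB.
by have := subset_leq_card (subsetIl A B); lia.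
Qed.

(** * A second set with the weight of [B] *)

(** The exchange that turns [S] into [S'] preserves weight, and the two inclusions allow the same
    exchange to be made in [B]. *)
Lemma between_shift S S' : between S -> between S' ->
  S :\: S' \subset B :\: A -> S' :\: S \subset A :\: B -> wt S = wt S' ->
  let T := (B :\: (S :\: S')) :|: (S' :\: S) in
  between T /\ wt T = wt B.
Proof.
move=> bS bS' /subsetP sB /subsetP sA eqw T.
have dT : [disjoint B :\: (S :\: S') & S' :\: S].
  rewrite disjoint_sym disjoint_subset; apply/subsetP => x /sA.
  by rewrite !inE => /andP[/negPf->]; rewrite andbF.
have sSB : S :\: S' \subset B.
  by apply/subsetP => x /sB; rewrite inE => /andP[].
split; last first.
  rewrite /T weightU // [RHS](weightID psi B (S :\: S')) addrC.
  rewrite (setIidPr sSB); congr (_ + _)%R.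
  move: eqw; rewrite (weightID psi S S') (weightID psi S' S) setIC.
  by move/addrI.
apply/and3P; split.
- apply/subsetP => x; rewrite !inE => /andP[xA xB].
  by rewrite (between_memI bS' xA xB) xB.
- apply/subsetP => x; rewrite inE => /orP[|/sA]; rewrite !inE.
    by case/andP=> _ ->; rewrite orbT.
  by case/andP=> _ ->.
rewrite /T cardsU (disjoint_setI0 dT) cards0 subn0 cardsDS //.
have := subset_leq_card sSB; rewrite -cAB.
have := cardsID S' S; have := cardsID S S'; rewrite setIC.
by rewrite (card_between bS) (card_between bS'); lia.
Qed.

(* Values are collected along a path of exchanges from [A] towards [B]; at
   each step two candidate sets are adjacent, so one of them has its weight in
   [F]. A repeated value along the path yields a second set of weight [wt B]. *)
Lemma path_values n : n < #|A :\: B| ->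
  (exists T, [/\ between T, T != B & wt T = wt B]) \/
  exists S, exists V : {fset Gamma},
    [/\ between S, #|A :\: S| = n, (V `<=` F)%fset, #|` V| = n.+1 &
        forall c, c \in V -> exists S', [/\ between S', wt S' = c,
          S :\: S' \subset B :\: A & S' :\: S \subset A :\: B]].
Proof.
elim: n => [|n IHn] ltn.
  right; exists A; exists [fset wt A]%fset; split.
  - exact: betweenA.
  - by rewrite setDv cards0.
  - by rewrite fsub1set.
  - by rewrite cardfs1.
  - move=> c; rewrite in_fset1 => /eqP->; exists A.
    by rewrite setDv !sub0set; split=> //; exact: betweenA.
case: (IHn (ltnW ltn)) => [|[S [V [bS cS sV cV HV]]]]; first by left.
have [a] : exists a, a \in (A :\: B) :\: (A :\: S).
  apply/set0Pn; rewrite -card_gt0.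
  have := subset_leq_card (subsetIr (A :\: B) (A :\: S)).
  by have := cardsD (A :\: B) (A :\: S); rewrite cS; lia.
rewrite !inE negb_and negbK => /andP[+ /andP[aB aA]].
rewrite aA orbF => aS.
have cSA : #|S :\: A| = n.
  have := cardsID S A; have := cardsID A S; rewrite setIC.
  by rewrite (card_between bS) cS; lia.
have cBA : #|B :\: A| = #|A :\: B|.
  have := cardsID A B; have := cardsID B A; rewrite setIC; lia.
have : 1 < #|(B :\: A) :\: (S :\: A)|.
  have := subset_leq_card (subsetIr (B :\: A) (S :\: A)).
  by have := cardsD (B :\: A) (S :\: A); rewrite cSA cBA; lia.
case/card_gt1P=> b1 [b2 []]; rewrite !inE !negb_and !negbK.
case/and3P=> b1S b1A b1B /and3P[b2S b2A b2B] b12.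
rewrite (negPf b1A) /= in b1S; rewrite (negPf b2A) /= in b2S.
have ma : movable a by rewrite aA (negPf aB).
have mb1 : movable b1 by rewrite b1B (negPf b1A).
have mb2 : movable b2 by rewrite b2B (negPf b2A).
have notB x y : x != y -> y \in B -> y \notin S -> swap S a x != B.
  move=> xy yB yS; apply: contraTneq yB => <-.
  by rewrite !inE (negPf yS) andbF orbF eq_sym.
have [b [bNA bB bNS wS]] : exists b,
    [/\ b \notin A, b \in B, b \notin S & wt (swap S a b) \in F].
  have e12 : swap (swap S a b1) b1 b2 = swap S a b2.
    rewrite /swap setU1K //; by rewrite !inE (negPf b1S) andbF.
  have b1S' : b1 \in swap S a b1 by rewrite !inE eqxx.
  have b2S' : b2 \notin swap S a b1.
    by rewrite !inE (negPf b2S) andbF orbF eq_sym.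
  have b21 : b2 != b1 by rewrite eq_sym.
  have := isolated (between_swap bS aS b1S ma mb1) b1S' b2S' mb1 mb2.
  rewrite e12 => /(_ (notB _ _ b12 b2B b2S) (notB _ _ b21 b1B b1S)).
  by case/orP=> w; [exists b1 | exists b2].
have mb : movable b by rewrite bB (negPf bNA).
have bS' := between_swap bS aS bNS ma mb.
have subs S' : S :\: S' \subset B :\: A -> S' :\: S \subset A :\: B ->
    swap S a b :\: S' \subset B :\: A /\ S' :\: swap S a b \subset A :\: B.
  move=> /subsetP sB /subsetP sA; split; apply/subsetP => x.
    rewrite inE in_swap => /andP[xS' /orP[/eqP->|/andP[_ xS]]].
      by rewrite inE bNA.
    by apply: sB; rewrite inE xS'.
  rewrite inE in_swap negb_or negb_and negbK => /andP[/andP[xb /orP[/eqP->|xS]] xS'].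
    by rewrite inE aB.
  by apply: sA; rewrite inE xS.
(* A repeated value is carried over to [B] by [between_shift]; the resulting set loses [b], so it is
   not [B]. *)
have [wV|wV] := boolP (wt (swap S a b) \in V).
  left; have [S' [bS1 eS' sB sA]] := HV _ wV.
  have [sB' sA'] := subs _ sB sA.
  have [bT eT] := between_shift bS' bS1 sB' sA' (esym eS').
  eexists; split; [exact: bT| |exact: eT].
  apply: contraTneq (bB) => <-.
  have bS'N : b \notin S'.
    apply/negP => bS2; have : b \in S' :\: S by rewrite inE bNS.
    by move/(subsetP sA); rewrite inE bB.
  by rewrite !inE eqxx (negPf bS'N).
right; exists (swap S a b), (wt (swap S a b) |` V)%fset; split=> //.
- have -> : A :\: swap S a b = a |: (A :\: S).
    apply/setP => x; rewrite !inE negb_or negb_and negbK.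
    have [->|xa] := eqVneq x a; rewrite /= ?aA ?andbT //.
      by apply: contraTneq aA => ->.
    by have [->|//] := eqVneq x b; rewrite (negPf bNA) !andbF.
  by rewrite cardsU1 inE aS cS.
- by rewrite fsubUset fsub1set wS.
- by rewrite cardfsU1 wV cV.
move=> c; rewrite in_fset1U => /orP[/eqP->|cV'].
  by exists (swap S a b); rewrite setDv !sub0set.
have [S' [bS1 eS' sB sA]] := HV _ cV'.
by have [sB' sA'] := subs _ sB sA; exists S'.
Qed.

(** These are the pairs whose exchange may start from or lead to [B], where [isolated] says
    nothing. *)
Definition separated (T : {set E}) : Prop := forall s t,
  s \in B :\: A -> t \in A :\: B -> psi s = psi t -> (s \in T) != (t \in T).

Lemma level_set : #|` F| < #|A :\: B| -> exists T,
  [/\ between T, T != B, wt T = wt B & separated T].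
Proof.
move=> ltF.
have [/existsP[b /andP[bD /existsP[a /andP[aD /eqP eab]]]]|] :=
  boolP [exists b in B :\: A, exists a in A :\: B, psi b == psi a]; last first.
  (* Separation is now vacuous, and a path with one exchange fewer than [#|A :\: B|] would give too
     many values in [F]. *)
  move=> noeq; have ltk : #|A :\: B|.-1 < #|A :\: B| by lia.
  case: (path_values ltk) => [[T [bT TB eT]]|[S [V [_ _ sV cV _]]]].
    exists T; split=> // s t sD tD est; case/negP: noeq.
    apply/existsP; exists s; rewrite sD; apply/existsP; exists t.
    by rewrite tD est eqxx.
  by have := fsubset_leq_card sV; rewrite cV; lia.
move: (bD) (aD); rewrite !inE => /andP[bA bB] /andP[aB aA].
have mb : movable b by rewrite bB (negPf bA).
have ma : movable a by rewrite aA (negPf aB).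
have neqB x : swap B x a != B.
  by apply: contraNneq aB => <-; rewrite !inE eqxx.
have eT : wt (swap B b a) = wt B by rewrite weight_swap // eab subrr addr0.
have bT : between (swap B b a) by apply: between_swap => //; exact: betweenB.
have ba : b != a by apply: contraNneq aB => <-.
exists (swap B b a); split=> // s t; rewrite !inE.
case/andP=> sA sB /andP[tB tA] est.
have ms : movable s by rewrite sB (negPf sA).
have mt : movable t by rewrite tA (negPf tB).
have sa : s != a by apply: contraNneq aB => <-.
have tb : t != b by apply: contraNneq tB => ->.
rewrite (negPf sa) (negPf tB) sB andbF orbF andbT /=.
(* Separation fails only if exactly one of [s = b] and [t = a] holds. Then a further exchange in
   [swap B b a] gives an adjacent set of weight [wt B], again not [B]. *)
have [esb|sb] := eqVneq s b; have [eta|ta] := eqVneq t a => //=; exfalso.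
  have e : swap (swap B b a) a t = swap B b t.
    by rewrite /swap setU1K // !inE (negPf aB) andbF.
  have aT : a \in swap B b a by rewrite in_swap eqxx.
  have tNT : t \notin swap B b a by rewrite in_swap (negPf ta) (negPf tB) andbF.
  have := isolated bT aT tNT ma mt (neqB b); rewrite e eT (negPf wtB) /=.
  rewrite weight_swap // -est esb subrr addr0 (negPf wtB).
  suff nB : swap B b t != B by move/(_ nB).
  by apply: contraNneq tB => <-; rewrite in_swap eqxx.
have := @isolated (swap B b a) s b bT; rewrite eT (negPf wtB) /=.
have sT : s \in swap B b a by rewrite !inE sb sB orbT.
have bNT : b \notin swap B b a by rewrite !inE eqxx (negPf ba).
rewrite weight_swap // eT eab est eta subrr addr0 (negPf wtB).
move=> /(_ sT bNT ms mb (neqB b)).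
suff nB : swap (swap B b a) s b != B by move/(_ nB).
by apply: contraNneq aB => <-; rewrite !in_swap eqxx [a == s]eq_sym sa orbT.
Qed.

(** * Values in [F] obtained by exchanges from the level set [T] *)

Section Growth.
Variable T : {set E}.
Hypotheses (bT : between T) (TB : T != B) (eT : wt T = wt B).
Hypothesis sepT : separated T.

(** The exchange of [s] and [t] preserves weight, so [isolated] applies unless one of the two sets
    is [B]; in that case [sepT] excludes the pair. *)
Lemma weight_split I s t : between I -> s \in I -> t \notin I ->
  movable s -> movable t -> psi s = psi t -> (s \in T) = (t \in T) ->
  wt I \in F.
Proof.
move=> bI sI tI ms mt est eTst; apply/negPn/negP => wI.
have st : s != t by apply: contraNneq tI => <-.
have sepC x y : x \in B -> y \notin B -> movable x -> movable y ->
    psi x = psi y -> (x \in T) = (y \in T) -> False.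
  move=> xB yB; rewrite xB (negPf yB); case xA: (x \in A) => //.
  case yA: (y \in A) => // _ _ exy; have := @sepT x y.
  by rewrite !inE xA yA xB yB exy => /(_ isT isT erefl) /eqP.
have := isolated bI sI tI ms mt.
rewrite weight_swap // est subrr addr0 (negPf wI) => H.
have [eIB|IB] := eqVneq I B.
  by apply: (sepC s t) => //; rewrite -eIB.
have [eIB|IB'] := eqVneq (swap I s t) B; last by have := H IB IB'.
apply: (sepC t s) => //; rewrite -eIB !inE eqxx //.
by rewrite (negPf st).
Qed.

Lemma weight_neighbor u v : u \in T -> v \notin T -> movable u -> movable v ->
  swap T u v != B -> wt (swap T u v) \in F.
Proof.
move=> uT vT mu mv nB; have := isolated bT uT vT mu mv TB nB.
by rewrite eT (negPf wtB).
Qed.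

(** The new set keeps [u'] and loses [u], so it splits a weight class within [T]; [weight_neighborr]
    does this outside [T]. *)
Lemma weight_neighborl u u' v : u \in T -> u' \in T -> u != u' ->
  movable u -> movable u' -> psi u = psi u' -> v \notin T -> movable v ->
  wt (swap T u v) \in F.
Proof.
move=> uT uT' uu' mu mu' eu vT mv.
apply: (@weight_split _ u' u); rewrite ?uT ?uT' //.
- exact: between_swap.
- by rewrite in_swap uT' [u' == u]eq_sym uu' orbT.
- by rewrite !inE eqxx orbF; apply: contraNneq vT => <-.
Qed.

Lemma weight_neighborr u v v' : u \in T -> movable u -> v \notin T ->
  v' \notin T -> v != v' -> movable v -> movable v' -> psi v = psi v' ->
  wt (swap T u v) \in F.
Proof.
move=> uT mu vT vT' vv' mv mv' ev.
apply: (@weight_split _ v v'); rewrite ?(negPf vT) ?(negPf vT') //.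
- exact: between_swap.
- by rewrite !inE eqxx.
- by rewrite !inE (negPf vT') andbF orbF eq_sym.
Qed.

Let X0 := [set x in T | movable x].
Let Y0 := [set x in ~: T | movable x].

Lemma injective_side : {in X0 &, injective psi} -> #|A :\: B| <= #|` F|.
Proof.
move=> inj.
have TA : T != A by apply: contraTneq wtA => <-; rewrite eT.
(* This [v] stays fixed: it is not in [B], so no [swap T u v] can be [B]. *)
have /subsetPn[v vA vT] : ~~ (A \subset T).
  apply: contraNN TA => sAT; rewrite eq_sym eqEcard sAT /=.
  by rewrite (card_between bT).
have vB : v \notin B.
  by apply: contraNN vT => vB; exact: between_memI vA vB.
have mv : movable v by rewrite vA (negPf vB).
rewrite -(card_movable_in bT) -/X0 cardE.
rewrite -(size_map (fun u => wt (swap T u v))).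
apply: uniq_leq_size.
  rewrite map_inj_in_uniq ?enum_uniq // => x y; rewrite !mem_enum => xX yX.
  move: (xX) (yX); rewrite !inE => /andP[xT mx] /andP[yT my].
  by rewrite !weight_swap // => /addrI /addrI /oppr_inj /inj ->.
move=> _ /mapP[u + ->]; rewrite mem_enum inE => /andP[uT mu].
apply: weight_neighbor => //.
by apply: contraNneq vB => <-; rewrite !inE eqxx.
Qed.

(** * The case of two equal weights in [T] *)

Section Star.
Variables (u1 u2 : E) (R : {set E}).
Hypotheses (u1X : u1 \in X0) (u2X : u2 \in X0) (u12 : u1 != u2).
Hypothesis eu : psi u1 = psi u2.
Hypotheses (RY : R \subset Y0) (injR : {in R &, injective psi}).
Hypothesis covR : forall y, y \in Y0 -> exists2 z, z \in R & psi z = psi y.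

(** Some [a] in [A :\: B] and [b] in [B :\: A] lie outside [T], and separation puts them in
    different classes. This bound leaves enough elements of [X0] besides [u1] and [u2] to pair with
    [Y0 :\: R]. *)
Lemma card_transversal_gt1 : 1 < #|R|.
Proof.
have TA : T != A by apply: contraTneq wtA => <-; rewrite eT.
have /subsetPn[a aA aT] : ~~ (A \subset T).
  apply: contraNN TA => sAT; rewrite eq_sym eqEcard sAT /=.
  by rewrite (card_between bT).
have /subsetPn[b bB bNT] : ~~ (B \subset T).
  apply: contraNN TB => sBT; rewrite eq_sym eqEcard sBT /=.
  by rewrite (card_between bT) cAB.
have aB : a \notin B.
  by apply: contraNN aT => aB; exact: between_memI aA aB.
have bA : b \notin A.
  by apply: contraNN bNT => bA; exact: between_memI bA bB.
have [|a' a'R ea] := covR (y := a).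
  by rewrite !inE aT aA (negPf aB).
have [|b' b'R eb] := covR (y := b).
  by rewrite !inE bNT bB (negPf bA).
apply/card_gt1P; exists a', b'; split=> //.
apply/eqP => e; have := @sepT b a.
by rewrite !inE aA bB aB bA -ea -eb e (negPf aT) (negPf bNT) => /(_ isT isT erefl).
Qed.

(* Each further exchange [(u, v)] keeps all values in [F], because the set it
   produces splits the class of [u1] or that of [v]; and it enlarges [V], since
   [V + d = V] together with [wt T + d \in V] would put [wt T] in [F]. *)
Lemma star_values n : n <= #|Y0 :\: R| ->
  exists V : {fset Gamma}, exists X Y : {set E},
  [/\ (V `<=` F)%fset, #|` V| = #|R| + n,
      [/\ X \subset X0 :\ u1 :\ u2, #|X| = n, Y \subset Y0 :\: R & #|Y| = n] &
      forall c, c \in V -> exists I, [/\ between I, wt I = c,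
        T :\: I \subset u1 |: X, I :\: T \subset R :|: Y &
        (u1 \notin I) || [disjoint I & R]]].
Proof.
move: (u1X) (u2X); rewrite !inE => /andP[u1T mu1] /andP[u2T mu2].
have RP v : v \in R -> v \notin T /\ movable v.
  by move/(subsetP RY); rewrite !inE => /andP[].
elim: n => [_|n IHn ltn].
  exists [fset wt (swap T u1 v) | v in R]%fset, set0, set0; split.
  - apply/fsubsetP => _ /imfsetP[v /= vR ->]; have [vT mv] := RP v vR.
    exact: (weight_neighborl u1T u2T).
  - rewrite addn0 card_in_imfset /= ?cardE // => v w vR wR.
    have [vT _] := RP v vR; have [wT _] := RP w wR.
    by rewrite !weight_swap // => /addrI /addIr /injR ->.
  - by rewrite !sub0set !cards0.
  move=> _ /imfsetP[v /= vR ->]; have [vT mv] := RP v vR.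
  exists (swap T u1 v); split=> //.
  - exact: between_swap.
  - apply/subsetP => x; rewrite !inE orbF negb_or negb_and negbK.
    by case/andP=> /andP[_ /orP[->//|/negPf->]].
  - apply/subsetP => x; rewrite !inE orbF.
    by case/andP=> /negPf-> /orP[/eqP->//|]; rewrite andbF.
  - by rewrite !inE eqxx orbF; apply/orP; left; apply: contraNneq vT => <-.
have [V [X [Y [sV cV [sX cX sY cY] HV]]]] := IHn (ltnW ltn).
have gt1 := card_transversal_gt1.
have [v] : exists v, v \in (Y0 :\: R) :\: Y.
  by apply/set0Pn; rewrite -card_gt0 cardsDS // cY subn_gt0.
rewrite inE => /andP[vY vYR]; move: (vYR); rewrite inE => /andP[vR vY0].
move: (vY0); rewrite !inE => /andP[vT mv].
have [u] : exists u, u \in (X0 :\ u1 :\ u2) :\: X.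
  apply/set0Pn; rewrite -card_gt0 cardsDS // cX subn_gt0.
  apply: leq_trans ltn _.
  have u2X' : u2 \in X0 :\ u1 by rewrite in_setD1 eq_sym u12.
  have cX0 : #|X0| = #|A :\: B| := card_movable_in bT.
  have cY0 : #|Y0| = #|A :\: B| := card_movable_out bT.
  have c1 := cardsD1 u1 X0; rewrite u1X in c1.
  have c2 := cardsD1 u2 (X0 :\ u1); rewrite u2X' in c2.
  rewrite cardsDS // cY0 -cX0 c1 c2 addnA.
  by rewrite leq_subLR leq_add2r.
rewrite inE => /andP[uX uXX]; move: (uXX).
rewrite !inE => /andP[uu2 /andP[uu1 /andP[uT mu]]].
have [w wR ew] := covR vY0; have [wT mw] := RP w wR.
have vw : v != w by apply: contraNneq vR => ->.
pose d := (psi v - psi u)%R.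
have wTd : (wt T + d)%R \in F.
  by rewrite -weight_swap //; exact: (weight_neighborr uT mu vT wT).
(* The pair is fresh: every set recorded so far contains [u] and misses [v], so the exchange shifts
   its weight by [d]. *)
have uI I : T :\: I \subset u1 |: X -> u \in I.
  move=> /subsetP sI; apply/negPn/negP => uI.
  have : u \in T :\: I by rewrite inE uI.
  by move/sI; rewrite !inE (negPf uu1) (negPf uX).
have vI I : I :\: T \subset R :|: Y -> v \notin I.
  move=> /subsetP sI; apply/negP => vI.
  have : v \in I :\: T by rewrite inE vT.
  by move/sI; rewrite inE (negPf vR) (negPf vY).
have step I : between I -> T :\: I \subset u1 |: X -> I :\: T \subset R :|: Y ->
    (u1 \notin I) || [disjoint I & R] ->
    [/\ between (swap I u v), wt (swap I u v) = (wt I + d)%R,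
      T :\: swap I u v \subset u1 |: (u |: X),
      swap I u v :\: T \subset R :|: (v |: Y) &
      (u1 \notin swap I u v) || [disjoint swap I u v & R]].
  move=> bI s1 s2 alt; have uI' := uI _ s1; have vI' := vI _ s2; split.
  - exact: between_swap.
  - exact: weight_swap.
  - apply/subsetP => x; rewrite inE in_swap negb_or negb_and negbK.
    case/andP=> /andP[_ /orP[/eqP->|xI]] xT; first by rewrite !inE eqxx orbT.
    have : x \in T :\: I by rewrite inE xI.
    by move/(subsetP s1); rewrite !inE => /orP[->//|->]; rewrite !orbT.
  - apply/subsetP => x; rewrite inE in_swap.
    case/andP=> xT /orP[/eqP->|/andP[_ xI]]; first by rewrite !inE eqxx orbT.
    have : x \in I :\: T by rewrite inE xI xT.
    by move/(subsetP s2); rewrite !inE => /orP[->//|->]; rewrite !orbT.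
  - case/orP: alt => [u1I|dIR]; apply/orP; [left|right].
      rewrite !inE (negPf u1I) andbF orbF.
      by apply: contraNneq vT => <-.
    rewrite disjoint_subset; apply/subsetP => x; rewrite !inE.
    case/orP=> [/eqP->//|/andP[_ xI]].
    by rewrite (disjointFr dIR xI).
(* If [u1] has left, [u2] is still present and their class is split. If [I] misses [R], then [v]
   enters while its representative [w] stays out. *)
have inF I : between I -> T :\: I \subset u1 |: X -> I :\: T \subset R :|: Y ->
    (u1 \notin I) || [disjoint I & R] -> (wt I + d)%R \in F.
  move=> bI s1 s2 alt; have uI' := uI _ s1; have vI' := vI _ s2.
  have [bS <- _ _ _] := step I bI s1 s2 alt.
  case/orP: alt => [u1I|dIR].
    apply: (@weight_split _ u2 u1); rewrite ?u1T ?u2T //.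
      have u2I : u2 \in I.
        apply/negPn/negP => u2I.
        have : u2 \in T :\: I by rewrite inE u2I.
        move/(subsetP s1); rewrite !inE eq_sym (negPf u12) /=.
        by move/(subsetP sX); rewrite !inE eqxx.
      by rewrite in_swap u2I [u2 == u]eq_sym uu2 orbT.
    by rewrite !inE (negPf u1I) andbF orbF; apply: contraNneq vT => <-.
  apply: (@weight_split _ v w); rewrite ?(negPf vT) ?(negPf wT) //.
    by rewrite !inE eqxx.
  by rewrite !inE (disjointFl dIR wR) andbF orbF eq_sym.
have grow c I : c \notin V -> c \in F -> c = wt I -> between I ->
    T :\: I \subset u1 |: (u |: X) -> I :\: T \subset R :|: (v |: Y) ->
    (u1 \notin I) || [disjoint I & R] ->
    exists V' : {fset Gamma}, exists X' Y' : {set E},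
    [/\ (V' `<=` F)%fset, #|` V'| = #|R| + n.+1,
      [/\ X' \subset X0 :\ u1 :\ u2, #|X'| = n.+1, Y' \subset Y0 :\: R & #|Y'| = n.+1] &
      forall c, c \in V' -> exists I, [/\ between I, wt I = c,
        T :\: I \subset u1 |: X', I :\: T \subset R :|: Y' &
        (u1 \notin I) || [disjoint I & R]]].
  move=> cV' cF ec bI s1 s2 alt.
  exists (c |` V)%fset, (u |: X), (v |: Y); split.
  - by rewrite fsubUset fsub1set cF.
  - by rewrite cardfsU1 cV' cV addnS.
  - by rewrite !subUset !sub1set uXX vYR sX sY !cardsU1 uX vY cX cY.
  move=> c'; rewrite in_fset1U => /orP[/eqP->|/HV [J [bJ eJ t1 t2 altJ]]].
    by exists I.
  exists J; split=> //.
    by apply: subset_trans t1 _; rewrite setUS // subsetUr.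
  by apply: subset_trans t2 _; rewrite setUS // subsetUr.
(* The new value is [wt T + d] if [V] lacks it, and otherwise some [c + d] with [c] in [V]. *)
have [wTV|wTV] := boolP ((wt T + d)%R \in V); last first.
  have dTR : [disjoint T & R].
    rewrite disjoint_sym disjoint_subset; apply/subsetP => x /RP[].
    by rewrite inE.
  have s0 (Z : {set E}) : T :\: T \subset Z by rewrite setDv sub0set.
  have altT : (u1 \notin T) || [disjoint T & R] by rewrite dTR orbT.
  have [b1 b2 b3 b4 b5] := step T bT (s0 _) (s0 _) altT.
  by apply: (grow (wt T + d)%R (swap T u v)).
have [/allP closedV|/allPn[c cV1 cV2]] :=
  boolP (all (fun c => (c + d)%R \in V) (enum_fset V)); last first.
  have [J [bJ eJ t1 t2 altJ]] := HV c cV1.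
  have [b1 b2 b3 b4 b5] := step J bJ t1 t2 altJ.
  apply: (grow (c + d)%R (swap J u v)) => //; last by rewrite b2 eJ.
  by rewrite -eJ; exact: inF.
(* Translation by [d] is injective, so a [V] closed under it is equal to its translate. *)
pose W := [fset (c + d)%R | c in V]%fset.
have eqVW : W = V.
  apply/eqP; rewrite eqEfcard; apply/andP; split.
    by apply/fsubsetP => _ /imfsetP[c /= cV1 ->]; exact: closedV.
  by rewrite card_imfset //; exact: addIr.
move: wTV; rewrite -eqVW => /imfsetP[c /= cV1] /addIr eTc.
by case/negP: wtB; rewrite -eT eTc (fsubsetP sV).
Qed.

End Star.

Lemma growth_bound : #|A :\: B| <= #|` F|.
Proof.
have [/dinjectiveP/injective_side//|] := boolP (dinjectiveb psi (mem X0)).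
case/dinjectivePn=> u1 u1X [u2]; rewrite inE => /andP[u21 u2X] eu.
have [R [RY injR covR]] := psi_transversal psi Y0.
have u12 : u1 != u2 by rewrite eq_sym.
(* Running through all of [Y0 :\: R] gives [#|R| + #|Y0 :\: R|] values, which is [#|A :\: B|]. *)
have [V [_ [_ [sV cV _ _]]]] := star_values u1X u2X u12 eu RY injR covR (leqnn _).
rewrite -(card_movable_out bT) -/Y0 -(cardsID R Y0) (setIidPr RY) -cV.
exact: fsubset_leq_card.
Qed.

End Growth.

Lemma interval_bound : #|A :\: B| <= #|` F|.
Proof.
rewrite leqNgt; apply/negP => ltF.
have [T [bT TB eT sepT]] := level_set ltF.
by have := growth_bound bT TB eT sepT; rewrite leqNgt ltF.
Qed.

End Interval.

(** * The avoiding basis closest to [A] *)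

Theorem theorem3p1 (E : finType) (M : matroid E) (Gamma : zmodType)
    (psi : E -> Gamma) (F : {fset Gamma})
    (hM : sparse_paving M)
    (hF : exists2 B : {set E}, B \in bases M & avoiding psi F B)
    (A : {set E}) (hA : A \in bases M) :
  exists B : {set E},
    [/\ B \in bases M, avoiding psi F B & #|A :\: B| <= #|` F|].
Proof.
case: hF => B' hB' avB'.
pose P := [pred X | (X \in bases M) && avoiding psi F X].
have PB' : P B' by rewrite /= hB'.
case: (arg_minnP (fun B : {set E} => #|A :\: B|) PB') => B /andP[hB avB] minB.
exists B; split=> //.
rewrite leqNgt; apply/negP => ltF.
suff : #|A :\: B| <= #|` F| by rewrite leqNgt ltF.
have cAB := bases_card hA hB.
have wtA : weight psi A \in F.
  apply/negPn/negP => avA.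
  have /minB : P A by rewrite /= hA.
  by rewrite setDv cards0 leqn0 => /eqP e0; rewrite e0 in ltF.
apply: (interval_bound (psi := psi)) => // I s t bI sI tI ms mt IB JB.
(* An avoiding basis [J] in between has [A :\: J] inside [A :\: B]; minimality makes these equal,
   which forces [J = B]. *)
have basisF J : between A B J -> J != B -> J \in bases M -> weight psi J \in F.
  move=> bJ JneqB hJ; apply/negPn/negP => avJ.
  have /minB leJ : P J by rewrite /= hJ.
  have sJ : A :\: J \subset A :\: B.
    apply/subsetP => x; rewrite !inE => /andP[xJ xA]; rewrite xA andbT.
    by apply: contraNN xJ => xB; exact: between_memI bJ xA xB.
  have /eqP eJ : A :\: J == A :\: B by rewrite eqEcard sJ.
  case/negP: JneqB; rewrite eqEcard (bases_card hJ hB) leqnn andbT.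
  apply/subsetP => x xJ; have := between_memU bJ xJ.
  case: (boolP (x \in A)) => //= xA _; apply/negPn/negP => xB.
  have : x \in A :\: B by rewrite inE xB.
  by rewrite -eJ inE xJ.
have [hI|hI] := boolP (I \in bases M); first by rewrite basisF.
apply/orP; right; apply: basisF => //; first exact: between_swap.
apply: nonbasis_swap => //.
by rewrite (card_between bI) (rank_card hA).
Qed.
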